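(* Let $\lambda_0,\lambda_1,\lambda_2>0$, $\lambda=\lambda_0+\lambda_1+\lambda_2$, and, with $N$, $(I_{1i},I_{2i},I_{0i})$ and $Y_{ki}$ as described in the context, let $S=\{S(t):t\ge0\}$ be the compound Poisson process $$S(t)=\sum_{i=0}^{N(t)}\left[I_{1i}Y_{1i}+I_{0i}(Y_{3i}+Y_{4i})+I_{2i}Y_{2i}\right],\qquad t\ge0.$$ Then for every $t\ge0$: (i) the distribution of $S(t)$ is determined by the Laplace–Stieltjes transform, for $z\ge0$, $$\mathbb{E}(e^{-zS(t)})=\exp\left\{-\lambda t\left[1-\frac{\lambda_1}{\lambda}\mathbb{E}e^{-zY_{11}}-\frac{\lambda_0}{\lambda}\mathbb{E}e^{-z(Y_{31}+Y_{41})}-\frac{\lambda_2}{\lambda}\mathbb{E}e^{-zY_{21}}\right]\right\};$$ (ii) if $\mathbb{E}Y_{k1}<\infty$ for $k=1,2,3,4$, then $\mathbb{E}(S(t))=t[\lambda_1\mathbb{E}Y_{11}+\lambda_0(\mathbb{E}Y_{31}+\mathbb{E}Y_{41})+\lambda_2\mathbb{E}Y_{21}]$; (iii) if $\mathbb{E}(Y_{k1}^2)<\infty$ for $k=1,2,3,4$, then $\mathrm{Var}(S(t))=t\left\{\lambda_1\mathbb{E}(Y_{11}^2)+\lambda_0\mathbb{E}[(Y_{31}+Y_{41})^2]+\lambda_2\mathbb{E}(Y_{21}^2)\right\}$.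
   Context: $N$ is a homogeneous Poisson process with parameter $\lambda$ and $N(0)=0$. The random vectors $(I_{1i},I_{2i},I_{0i})$, $i\ge1$, are i.i.d. and take the values $(1,0,0)$, $(0,1,0)$, $(0,0,1)$ with probabilities $\lambda_1/\lambda$, $\lambda_2/\lambda$, $\lambda_0/\lambda$ respectively. For each $k=1,2,3,4$ the random variables $Y_{k1},Y_{k2},\dots$ are i.i.d. and almost surely strictly positive; the pairs $(Y_{3i},Y_{4i})$, $i\ge1$, are i.i.d. (the two coordinates of a pair may be dependent). $N$ and the sequences $\{Y_{1i}\}_{i\ge1}$, $\{Y_{2i}\}_{i\ge1}$, $\{(Y_{3i},Y_{4i})\}_{i\ge1}$, $\{(I_{1i},I_{2i},I_{0i})\}_{i\ge1}$ are mutually independent. The terms with $i=0$ in the sums are $0$. *)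

(* Defs.v *)
From HB Require Import structures.
From mathcomp Require Export all_boot all_order all_algebra finmap.
From mathcomp Require Export all_classical all_reals all_analysis measurable_realfun.
Export Order.TTheory GRing.Theory Num.Theory numFieldNormedType.Exports.

Set Implicit Arguments.
Unset Strict Implicit.
Unset Printing Implicit Defensive.

Local Open Scope classical_set_scope.
Local Open Scope ring_scope.

Section independence.
Context d (T : measurableType d) (R : realType) (P : probability T R).

(* Product rule over every finite subfamily of the set systems F j, j in D;
   it is used below with sigma-algebras contained in that of T. *)
Definition independent_systems (J : choiceType) (D : set J)
    (F : J -> set (set T)) : Prop :=
  forall (A : {fset J}) (E : J -> set T),
    (forall j, j \in A -> D j /\ F j (E j)) ->
    P (\bigcap_(j in [set` A]) E j) = (\prod_(j <- A) P (E j))%E.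

Definition generated_sigma (J : Type) d' (T' : measurableType d') (D : set J)
    (X : J -> T -> T') : set (set T) :=
  <<s \bigcup_(j in D) preimage_set_system setT (X j) measurable >>.

Definition independent_RVs (J : choiceType) d' (T' : measurableType d')
    (D : set J) (X : J -> T -> T') : Prop :=
  independent_systems D
    (fun j => preimage_set_system setT (X j) measurable).

Definition identically_distributed (J : Type) d' (T' : measurableType d')
    (D : set J) (X : J -> T -> T') : Prop :=
  forall i j, D i -> D j ->
    forall B : set T', measurable B -> P (X i @^-1` B) = P (X j @^-1` B).

(* Sequences are indexed by i >= 1; a term of index 0 is never used. *)
Definition iid d' (T' : measurableType d') (X : nat -> T -> T') : Prop :=
  independent_RVs [set i | (1 <= i)%N] X /\
  identically_distributed [set i | (1 <= i)%N] X.

Definition sigma_seq d' (T' : measurableType d') (X : nat -> T -> T') :=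
  generated_sigma [set i | (1 <= i)%N] X.

End independence.

Section poisson_process.
Context d (T : measurableType d) (R : realType) (P : probability T R).

(* Only the times t >= 0 matter.  Since the paths are nondecreasing, the
   truncated subtraction on nat is the true increment. *)
Record poisson_process (lambda : R) (N : R -> {RV P >-> nat}) : Prop := {
  poisson_start : forall w, N 0 w = 0%N ;
  poisson_nondecreasing : forall w (s t : R), 0 <= s -> s <= t ->
    (N s w <= N t w)%N ;
  poisson_right_continuous : forall w (t : R), 0 <= t ->
    N s w @[s --> t^'+] --> N t w ;
  poisson_independent_increments : forall (n : nat) (t : nat -> R),
    0 <= t 0%N -> (forall i, (i < n)%N -> t i < t i.+1) ->
    independent_RVs P [set i | (i < n)%N]
      (fun i w => (N (t i.+1) w - N (t i) w)%N) ;
  poisson_increments : forall (s t : R) (k : nat), 0 <= s -> s < t ->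
    P [set w | (N t w - N s w)%N = k] = (poisson_pmf (lambda * (t - s)) k)%:E
}.

End poisson_process.

Section compound_sum.
Context d (T : measurableType d) (R : realType) (P : probability T R).
Variables (N : R -> {RV P >-> nat}).
Variables (I1 I2 I0 Y1 Y2 Y3 Y4 : nat -> {RV P >-> R}).

(* The sum starts at i = 1 because the term i = 0 is 0 by convention. *)
Definition compound_sum (t : R) (w : T) : R :=
  \sum_(1 <= i < (N t w).+1)
    (I1 i w * Y1 i w + I0 i w * (Y3 i w + Y4 i w) + I2 i w * Y2 i w).

Lemma measurable_compound_sum (t : R) :
  measurable_fun setT (compound_sum t).
Proof.
pose F (n : nat) (w : T) : R := \sum_(1 <= i < n.+1)
    (I1 i w * Y1 i w + I0 i w * (Y3 i w + Y4 i w) + I2 i w * Y2 i w).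
have mF n : measurable_fun setT (F n).
  apply: measurable_sum => i.
  apply: measurable_funD; [apply: measurable_funD|]; apply: measurable_funM => //.
  exact: measurable_funD.
move=> _ B mB; rewrite setTI.
have -> : compound_sum t @^-1` B =
    \bigcup_n ((N t @^-1` [set n]) `&` (F n @^-1` B)).
  apply/seteqP; split=> [w Bw|w [n _ [/= <-]]//].
  by exists (N t w).
apply: bigcupT_measurable => n; apply: measurableI.
  by rewrite -[X in measurable X]setTI; exact: measurable_funP.
by rewrite -[X in measurable X]setTI; exact: mF.
Qed.

HB.instance Definition _ (t : R) :=
  isMeasurableFun.Build _ _ _ _ (compound_sum t) (measurable_compound_sum t).

End compound_sum.

(* Main.v *)
From HB Require Import structures.
Require Import Defs.
From mathcomp Require Import ring lra.

Set Implicit Arguments.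
Unset Strict Implicit.
Unset Printing Implicit Defensive.

Local Open Scope classical_set_scope.
Local Open Scope ring_scope.

(** Write J_i for the i-th term of the compound sum.  Its mark
    (I_1i, I_2i, I_0i) almost surely names one of three kinds of claims, of
    probabilities p_a, and J_i is then the claim W_ai of that kind, namely
    Y_1i, Y_2i or Y_3i + Y_4i.  Hence J_1, J_2, ... are i.i.d. with the mixture
    law of the W_a and independent of N, so that S(t) is a compound Poisson
    variable; everything follows by conditioning on N(t) = k.

    The only form of independence needed is [jump_factorization]: on the event
    N(t) = k,

      E[1(N(t) = k) prod_i g_i(J_i)] = P(N(t) = k) prod_i sum_a p_a E[g_i(W_a)].

    To get it, the left-hand side is expanded over all assignments f of kinds to
    the n jumps.  For a fixed f the event that the marks follow f and the claims
    W_(f i, i) belong to prescribed sets is an intersection of one event per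
    independent block (N, Y_1, Y_2, the pairs, the marks), each of which
    factorizes because its sequence is i.i.d.: [block_factorization].  Product
    rules for events become product rules for integrals of nonnegative
    functions by [ge0_integral_prod_indep], and distributivity of the product
    over the sum folds the assignments back into a product of mixtures.

    With g_i(x) = exp(-zx) the sum over k is the Poisson generating function and
    gives the transform.  With |x| in one factor, x^2 in one factor, or |x| in
    two distinct factors, the sums over k are the factorial moments of the
    Poisson law, computed by the identity [poisson_stein]; writing r for
    lambda t, M and Q for the first two moments of a jump, one finds
    E S = r M and E S^2 = r Q + (r M)^2, whence the mean and the variance.
    Absolute values keep all integrands nonnegative everywhere; they are removed
    at the end since claims are positive almost surely.

    That the transform determines the law is [laplace_injective].  For x >= 0
    the functions (1 - exp(-nx))^m with m about n exp(na) tend to the indicator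
    of the ray x > a while staying in [0, 1], and they are linear combinations
    of exponentials exp(-zx), z >= 0.  Two laws on the half-line with the same
    transform therefore agree on rays, by dominated convergence, hence
    everywhere. *)

(** * Expectations of products of independent functions *)

Section product_expectation.
Local Open Scope ereal_scope.
Import HBNNSimple.
Context d (T : measurableType d) (R : realType).

(** Both sides are limits of the same expression: f is a limit of simple
    functions phi_n(f), and the integral of phi_n(f) against a weight involves
    the weight only through its masses on the sets f^-1(phi_n = k).  The weights
    may take the value +oo, which makes the lemma applicable to products of
    expectations that are not known to be finite. *)
Lemma eq_integral_weight (mu : {measure set T -> \bar R}) (f : T -> R)
    (H1 H2 : T -> \bar R) :
  measurable_fun setT f -> (forall x, 0 <= f x)%R ->
  measurable_fun setT H1 -> measurable_fun setT H2 ->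
  (forall x, 0 <= H1 x) -> (forall x, 0 <= H2 x) ->
  (forall B, measurable B ->
    \int[mu]_(x in f @^-1` B) H1 x = \int[mu]_(x in f @^-1` B) H2 x) ->
  \int[mu]_x ((f x)%:E * H1 x) = \int[mu]_x ((f x)%:E * H2 x).
Proof.
move=> mf f0 mH1 mH2 H10 H20 H12.
have mabs : measurable_fun setT (fun y : R => `|y|%:E) by exact/measurable_EFinP.
(* Approximating the absolute value on R, rather than f on T, produces level
   sets of the form f @^-1` B; it coincides with the identity on values of f. *)
pose phi := nnsfun_approx measurableT mabs.
have key H : measurable_fun setT H -> (forall x, 0 <= H x) ->
    \int[mu]_x ((f x)%:E * H x) = limn (fun n => \sum_(k \in range (phi n))
      (`|k|%:E * \int[mu]_(x in f @^-1` (phi n @^-1` [set k])) H x)).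
  move=> mH H0.
  have mphif n : measurable_fun setT (fun x => (phi n (f x))%:E).
    by apply/measurable_EFinP; apply: measurableT_comp.
  have mA n k : measurable (f @^-1` (phi n @^-1` [set k])).
    by rewrite -[X in measurable X]setTI; exact: mf.
  transitivity (\int[mu]_x limn (fun n => (phi n (f x))%:E * H x)).
    apply: eq_integral => x _; apply/esym/cvg_lim => //.
    (* When f x = 0 and H x = +oo the limit of a product is not covered by
       continuity of the multiplication; but then phi_n (f x) = 0 as well. *)
    have [fx0|fx0] := eqVneq (f x) 0%R.
      rewrite fx0 mul0e (_ : (fun n => _) = cst 0); first exact: cvg_cst.
      apply/funext => n /=; suff -> : phi n 0%R = 0%R by rewrite mul0e.
      apply/eqP; rewrite eq_le fun_ge0 andbT -lee_fin nnsfun_approxE.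
      by rewrite (le_trans (le_approx n _ _))//= normr0.
    apply: cvgeM; last exact: cvg_cst.
      have [Hx|Hx] := boolP (H x \is a fin_num); first exact: mule_def_fin.
      exact: mule_def_neq0_infty.
    have -> : (f x)%:E = `|f x|%:E by rewrite ger0_norm.
    exact: (cvg_nnsfun_approx measurableT mabs).
  rewrite monotone_convergence//; last 3 first.
  - by move=> n; apply: emeasurable_funM.
  - by move=> n x _; rewrite mule_ge0// lee_fin.
  - move=> x _ m n mn; rewrite lee_wpmul2r// lee_fin.
    by have /lefP := nd_nnsfun_approx measurableT mabs mn; exact.
  congr (limn _); apply/funext => n.
  transitivity (\int[mu]_x (\sum_(k \in range (phi n))
     `|k|%:E * (H \_ (f @^-1` (phi n @^-1` [set k]))) x)).
    apply: eq_integral => x _; rewrite (fimfunE (phi n) (f x)).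
    rewrite -fsumEFin//.
    rewrite (eq_fsbigr (fun k =>
      (`|k| * \1_(phi n @^-1` [set k]) (f x))%R%:E)); last first.
      by move=> k /[!inE] -[y _ <-]; rewrite (ger0_norm (fun_ge0 _)).
    rewrite ge0_mule_fsuml; last by move=> k; rewrite lee_fin mulr_ge0.
    apply: eq_fsbigr => k _; rewrite patchE indicE/=.
    have -> : (x \in f @^-1` (phi n @^-1` [set k])) =
              (f x \in phi n @^-1` [set k]) by apply/idP/idP; rewrite !inE.
    by case: ifP; rewrite ?mulr1 ?mulr0 ?mul0e ?mule0.
  rewrite ge0_integral_fsum//; last 2 first.
  - move=> k; apply: emeasurable_funM => //.
    by apply/(measurable_restrictT _ _).1 => //; apply: measurable_funTS.
  - by move=> k x _; rewrite mule_ge0// ?lee_fin// erestrict_ge0.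
  apply: eq_fsbigr => k _; rewrite ge0_integralZl ?lee_fin//.
  - by rewrite -integral_mkcond.
  - by apply/(measurable_restrictT _ _).1 => //; apply: measurable_funTS.
  - by move=> x _; rewrite erestrict_ge0.
rewrite !key//; congr (limn _); apply/funext => n.
by apply: eq_fsbigr => k _; rewrite H12.
Qed.

(** The sets f j @^-1` B j are traded for the functions f j one index at a time.
    Keeping an event A in front makes the induction work: after the first index
    is removed, A is replaced by A `&` f a @^-1` B, and the induction hypothesis
    says that the product of the remaining functions, restricted to A, has the
    same masses on the sets f a @^-1` B as a constant weight. *)
Lemma ge0_integral_prod_indep (P : probability T R) (J : choiceType) (s : seq J)
    (f : J -> T -> R) (A : set T) :
  uniq s -> measurable A ->
  (forall j, measurable_fun setT (f j)) -> (forall j x, 0 <= f j x)%R ->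
  (forall B : J -> set R, (forall j, measurable (B j)) ->
    P (A `&` \big[setI/setT]_(j <- s) (f j @^-1` B j)) =
      P A * \prod_(j <- s) P (f j @^-1` B j)) ->
  \int[P]_(x in A) (\prod_(j <- s) (f j x)%:E) =
    P A * \prod_(j <- s) \int[P]_x (f j x)%:E.
Proof.
move=> + + mf f0; elim: s A => [|a s IH] A.
  move=> _ mA _; under eq_integral do rewrite big_nil.
  by rewrite big_nil mule1 integral_cst// mul1e.
move=> /= /andP[as_ us] mA indep.
have mfB j B : measurable B -> measurable (f j @^-1` B).
  by move=> mB; rewrite -[X in measurable X]setTI; exact: mf.
pose E := \prod_(j <- s) \int[P]_x (f j x)%:E.
pose H x : \bar R := \prod_(j <- s) (f j x)%:E.
have H0 x : 0 <= H x by rewrite prode_ge0// => j _; rewrite lee_fin.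
have E0 : 0 <= E.
  by rewrite prode_ge0// => j _; apply: integral_ge0 => x _; rewrite lee_fin.
have mH : measurable_fun setT H.
  rewrite /H; under eq_fun do rewrite prodEFin.
  by apply/measurable_EFinP; exact: measurable_prod.
have indepa B : measurable B ->
    P (A `&` f a @^-1` B) = P A * P (f a @^-1` B).
  move=> mB; have := indep (fun j => if j == a then B else setT).
  have sT : \big[setI/setT]_(j <- s) (f j @^-1` (if j == a then B else setT)) = setT.
    rewrite big_seq big1// => j js; case: eqP => [ja|_]; last by rewrite preimage_setT.
    by move: as_; rewrite -ja js.
  rewrite !big_cons sT eqxx setIT => ->; last by move=> j; case: ifP.
  rewrite big_seq big1 ?mule1// => j js; case: eqP => [ja|_].
    by move: as_; rewrite -ja js.
  by rewrite preimage_setT probability_setT.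
have {}IH B : measurable B ->
    \int[P]_(x in A `&` f a @^-1` B) H x = P A * P (f a @^-1` B) * E.
  move=> mB; rewrite IH//; [by rewrite indepa| exact: measurableI (mfB _ _ _)|].
  move=> B' mB'; have := indep (fun j => if j == a then B else B' j).
  rewrite !big_cons eqxx setIA indepa//.
  have eqs : {in s, forall j, (if j == a then B else B' j) = B' j}.
    by move=> j js; case: eqP => // ja; move: as_; rewrite -ja js.
  have -> : \big[setI/setT]_(j <- s) (f j @^-1` (if j == a then B else B' j)) =
            \big[setI/setT]_(j <- s) (f j @^-1` B' j).
    by rewrite big_seq [RHS]big_seq; apply: eq_bigr => j js; rewrite eqs.
  have -> : \prod_(j <- s) P (f j @^-1` (if j == a then B else B' j)) =
            \prod_(j <- s) P (f j @^-1` B' j).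
    by rewrite big_seq [RHS]big_seq; apply: eq_bigr => j js; rewrite eqs.
  by move=> ->; [rewrite muleA | move=> j; case: ifP].
rewrite big_cons integral_mkcond.
transitivity (\int[P]_x ((f a x)%:E * (H \_ A) x)).
  apply: eq_integral => x _; rewrite !patchE; case: ifP; rewrite ?mule0//.
  by rewrite big_cons.
have mHA : measurable_fun setT (H \_ A).
  by apply/(measurable_restrictT _ _).1 => //; apply: measurable_funTS.
rewrite (@eq_integral_weight _ _ _ (cst (P A * E)))//; last 3 first.
- by move=> x; rewrite erestrict_ge0.
- by move=> x; rewrite mule_ge0.
- move=> B mB; rewrite -integral_mkcondr setIC IH// integral_cst//; last exact: mfB.
  by rewrite muleAC.
rewrite ge0_integralZr//; last 3 first.
- exact/measurable_EFinP.
- by move=> x _; rewrite lee_fin.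
- by rewrite mule_ge0.
by rewrite muleC -muleA; congr (_ * _); rewrite muleC.
Qed.
End product_expectation.

(** * Series over the Poisson weights *)

Section poisson_series.
Context (R : realType).
Implicit Types r q : R.

(** For r > 0 this is the Poisson mass function; unlike [poisson_pmf] it is also
    correct for r = 0, where it is the Dirac mass at 0.  This is what makes the
    time t = 0 a case like the others. *)
Definition poisson_weight r k : R := exp_coeff r k * expR (- r).

Lemma poisson_weight_ge0 r k : 0 <= r -> 0 <= poisson_weight r k.
Proof. by move=> r0; rewrite mulr_ge0 ?expR_ge0// exp_coeff_ge0. Qed.

Local Open Scope ereal_scope.

Lemma nneseries_exp_coeff r : (0 <= r)%R ->
  \sum_(0 <= k <oo) (exp_coeff r k)%:E = (expR r)%:E.
Proof.
move=> r0; rewrite /expR -EFin_lim; last exact: is_cvg_series_exp_coeff.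
by congr (limn _); apply/funext => n; rewrite /= -sumEFin.
Qed.

Lemma poisson_pgf r q : (0 <= r)%R -> (0 <= q)%R ->
  \sum_(0 <= k <oo) (poisson_weight r k * q ^+ k)%:E = (expR (- (r * (1 - q))))%:E.
Proof.
move=> r0 q0.
transitivity (\sum_(0 <= k <oo) ((expR (- r))%:E * (exp_coeff (r * q) k)%:E)).
  apply: eq_eseriesr => k _; rewrite -EFinM; congr EFin.
  by rewrite /poisson_weight /exp_coeff/= exprMn; ring.
rewrite nneseriesZl; last by move=> k _; rewrite lee_fin exp_coeff_ge0// mulr_ge0.
rewrite nneseries_exp_coeff ?mulr_ge0// -EFinM -expRD; congr (expR _)%:E; ring.
Qed.

(** The Stein-Chen identity E[K v(K)] = r E[v(K + 1)], which holds because
    (k + 1) w(k + 1) = r w(k) for the weights w.  Each use lowers the degree of a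
    moment by one. *)
Lemma poisson_stein r (v : nat -> R) : (0 <= r)%R -> (forall k, 0 <= v k)%R ->
  \sum_(0 <= k <oo) (poisson_weight r k * (k%:R * v k))%:E =
  r%:E * \sum_(0 <= k <oo) (poisson_weight r k * v k.+1)%:E.
Proof.
move=> r0 v0; have w0 k := poisson_weight_ge0 k r0.
rewrite nneseries_recl//; last by move=> k _; rewrite lee_fin (mulr_ge0 (w0 k))// mulr_ge0.
rewrite mul0r mulr0 add0e -nneseries_addn; last first.
  by move=> k; rewrite lee_fin (mulr_ge0 (w0 k))// mulr_ge0.
rewrite -nneseriesZl; last by move=> k _; rewrite lee_fin (mulr_ge0 (w0 k)).
apply: eq_eseriesr => k _; rewrite -EFinM addn1; congr EFin.
rewrite /poisson_weight /exp_coeff/= factS natrM exprS invfM.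
have k0 : (k.+1%:R : R) != 0%R by rewrite pnatr_eq0.
have f0 : (k`!%:R : R) != 0%R by rewrite pnatr_eq0 -lt0n fact_gt0.
by field; rewrite f0/= nat1r.
Qed.

Lemma poisson_total r : (0 <= r)%R ->
  \sum_(0 <= k <oo) (poisson_weight r k)%:E = 1.
Proof.
move=> r0; have := poisson_pgf r0 ler01; under eq_eseriesr do rewrite expr1n mulr1.
by move=> ->; rewrite subrr mulr0 oppr0 expR0.
Qed.

Lemma poisson_mean r : (0 <= r)%R ->
  \sum_(0 <= k <oo) (poisson_weight r k * k%:R)%:E = r%:E.
Proof.
move=> r0; have := poisson_stein r0 (fun=> ler01).
under eq_eseriesr do rewrite mulr1.
by under [X in _ = _ * X]eq_eseriesr do rewrite mulr1; rewrite poisson_total// mule1.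
Qed.

Lemma poisson_factorial_moment2 r : (0 <= r)%R ->
  \sum_(0 <= k <oo) (poisson_weight r k * (k%:R * k.-1%:R))%:E = (r ^+ 2)%:E.
Proof.
by move=> r0; rewrite (@poisson_stein r (fun k => k.-1%:R))//= poisson_mean.
Qed.

End poisson_series.

(** * Uniqueness for Laplace transforms on the half-line *)

Section laplace_uniqueness.
Context (R : realType).
Implicit Types (a u x z : R) (n m : nat).

(** These two inequalities control (1 - u)^m on both sides of the threshold of
    order m = 1/u: it is close to 1 when m u is small, and to 0 when m u is
    large. *)
Lemma exprB1_ge u m : 0 <= u <= 1 -> 1 - m%:R * u <= (1 - u) ^+ m.
Proof.
move=> /andP[u0 u1]; elim: m => [|m IH]; first by rewrite mul0r subr0 expr0.
rewrite exprS -natr1; have m0 : (0 : R) <= m%:R by [].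
apply: (@le_trans _ _ ((1 - u) * (1 - m%:R * u))); last by rewrite ler_wpM2l// subr_ge0.
rewrite -subr_ge0 (_ : _ - _ = m%:R * u ^+ 2); last by ring.
by rewrite mulr_ge0 ?exprn_ge0.
Qed.

Lemma exprB1_le u m : 0 <= u <= 1 -> (1 - u) ^+ m * (1 + m%:R * u) <= 1.
Proof.
move=> /andP[u0 u1]; elim: m => [|m IH]; first by rewrite mul0r addr0 expr0 mulr1.
rewrite exprS -natr1; have m0 : (0 : R) <= m%:R by [].
apply: le_trans IH; rewrite mulrAC mulrC ler_wpM2l ?exprn_ge0 ?subr_ge0//.
rewrite -subr_ge0 (_ : _ - _ = (m%:R + 1) * u ^+ 2); last by ring.
by rewrite mulr_ge0 ?exprn_ge0// addr_ge0.
Qed.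

(** With u = exp(-nx), the exponent m, about n exp(na), is chosen so that m u is
    about n exp(n(a - x)): this tends to 0 for x > a and to infinity for x <= a.
    The extra factor n settles the boundary case x = a.  The index is shifted by
    one to avoid n = 0. *)
Definition ray_approx a n x : R :=
  (1 - expR (- (n.+1%:R * x))) ^+ Num.truncn (n.+1%:R * expR (n.+1%:R * a)).

Lemma expRN_itv x : 0 <= x -> 0 <= expR (- x) <= 1.
Proof. by move=> x0; rewrite expR_ge0/= -expR0 ler_expR oppr_le0. Qed.

Lemma ray_approx_itv a n x : 0 <= x -> 0 <= ray_approx a n x <= 1.
Proof.
move=> x0; have /andP[u0 u1] := @expRN_itv (n.+1%:R * x) (mulr_ge0 (ler0n _ _) x0).
by rewrite exprn_ge0 ?exprn_ile1 ?subr_ge0// lerBlDr lerDl.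
Qed.

Lemma cvg_ray_approx a x : 0 <= x ->
  ray_approx a n x @[n --> \oo] --> (\1_`]a, +oo[ x : R).
Proof.
move=> x0; have u01 n := @expRN_itv (n.+1%:R * x) (mulr_ge0 (ler0n _ _) x0).
rewrite indicE; case: (boolP (x \in _)); rewrite ?inE ?notin_setE/= in_itv/= andbT => ax.
  (* From exp(y) >= y^2/2 with y = n(x - a) one gets m u <= c/n. *)
  pose c := 2 / (x - a) ^+ 2.
  have xa : 0 < x - a by rewrite subr_gt0.
  apply: (@squeeze_cvgr _ _ _ _ (fun n => 1 - c * harmonic n) (fun=> 1)).
  - near=> n; have /andP[_ ->] := ray_approx_itv a n x0; rewrite andbT.
    apply: le_trans (exprB1_ge _ (u01 n)); rewrite lerD2l lerN2.
    set k := n.+1%:R; have k0 : 0 < k :> R by rewrite ltr0n.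
    apply: (@le_trans _ _ (k * expR (k * a) * expR (- (k * x)))).
      by rewrite ler_wpM2r ?expR_ge0// truncn_le mulr_ge0 ?expR_ge0// ltW.
    rewrite -mulrA -expRD -(_ : - (k * (x - a)) = k * a - k * x); last by ring.
    rewrite expRN ler_pdivrMr ?expR_gt0//.
    have y0 : 0 <= k * (x - a) by rewrite mulr_ge0 ?ltW.
    have := expR_ge1Dxn 1 y0; rewrite /harmonic/= -/k => ey.
    apply: (@le_trans _ _ (c * k^-1 * (k * (x - a)) ^+ 2 / 2)).
      rewrite (_ : _ / 2 = k)// /c; field; rewrite ?gt_eqF//.
    rewrite -mulrA ler_wpM2l//; last by apply: le_trans ey; rewrite lerDr.
    by rewrite mulr_ge0 ?invr_ge0 ?(ltW k0)// /c mulr_ge0 ?invr_ge0 ?exprn_ge0 ?(ltW xa).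
  - rewrite -[X in _ --> X]subr0 -[X in _ - X](mulr0 c); apply: cvgB; first exact: cvg_cst.
    by apply: cvgMl_tmp; exact: cvg_harmonic.
  - exact: cvg_cst.
apply: (@squeeze_cvgr _ _ _ _ (fun=> 0) harmonic); [|exact: cvg_cst|exact: cvg_harmonic].
near=> n; have /andP[->/= _] := ray_approx_itv a n x0.
rewrite /harmonic/=; set k := n.+1%:R; have k0 : 0 < k :> R by rewrite ltr0n.
rewrite -[_^-1]mul1r ler_pdivlMr//.
have /andP[h0 _] := ray_approx_itv a n x0.
apply: le_trans (exprB1_le (Num.truncn (k * expR (k * a))) (u01 n)).
rewrite ler_wpM2l//.
(* Since m > k exp(ka) - 1 and u <= 1, the factor 1 + m u is at least k. *)
have := truncnS_gt (k * expR (k * a)); rewrite -natr1 => mk.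
have /andP[u0 u1] := u01 n.
have : k * expR (k * a) * expR (- (k * x)) >= k.
  rewrite -mulrA -expRD ler_pMr// -expR0 ler_expR.
  have -> : k * a - k * x = k * (a - x) by ring.
  by rewrite mulr_ge0 ?(ltW k0)// subr_ge0 leNgt; exact/negP.
rewrite -/k in u0 u1 *; set m := (Num.truncn _)%:R in mk *.
set u := expR _ in u0 u1 *; set e := _ * expR _ in mk * => h.
have : 0 <= (m + 1 - e) * u by rewrite mulr_ge0// subr_ge0 ltW.
nra.
Unshelve. all: by end_near. Qed.

Local Open Scope ereal_scope.

Let D : set (measurableTypeR R) := `[0%R, +oo[%classic.

Let mD : measurable D. Proof. exact: measurable_itv. Qed.

Let mexp c : measurable_fun [set: measurableTypeR R]
  (fun x : measurableTypeR R => expR (- (c * x))).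
Proof. by apply: (measurableT_comp (@measurable_expR R)); exact: measurableT_comp. Qed.

Let mexp_pow z c m : measurable_fun D (fun x : measurableTypeR R =>
  (expR (- (z * x)) * (1 - expR (- (c * x))) ^+ m)%:E).
Proof.
apply/measurable_EFinP/measurable_funTS; apply: measurable_funM => //.
by apply: measurable_funX; apply: measurable_funB.
Qed.

Let D_ge0 x : D x -> (0 <= x)%R.
Proof. by rewrite /D/= in_itv/= andbT. Qed.

Let exp_pow_ge0 z c m x : (0 <= c)%R -> D x ->
  (0 <= expR (- (z * x)) * (1 - expR (- (c * x))) ^+ m)%R.
Proof.
move=> c0 /D_ge0 x0; rewrite mulr_ge0 ?expR_ge0// exprn_ge0// subr_ge0.
by have /andP[] := expRN_itv (mulr_ge0 c0 x0).
Qed.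

Section determined.
Variables mu nu : probability (measurableTypeR R) R.
Hypothesis muD : mu [set x : R | (0 <= x)%R] = 1.
Hypothesis nuD : nu [set x : R | (0 <= x)%R] = 1.
Hypothesis laplaceE : forall z, (0 <= z)%R ->
  \int[mu]_x (expR (- z * x))%:E = \int[nu]_x (expR (- z * x))%:E.

Let DE : [set x : R | (0 <= x)%R] = D.
Proof. by apply/seteqP; split => x; rewrite /D/= in_itv/= andbT. Qed.

Let muD1 : mu D = 1. Proof. by rewrite -DE. Qed.
Let nuD1 : nu D = 1. Proof. by rewrite -DE. Qed.

(* The approximations are bounded on D only, so all integrals are moved there. *)
Let integral_concentrated (P : probability (measurableTypeR R) R) (f : R -> \bar R) :
  P D = 1 -> measurable_fun [set: measurableTypeR R] f -> (forall x, 0 <= f x) ->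
  \int[P]_x f x = \int[P]_(x in D) f x.
Proof.
move=> PD mf f0; rewrite (@ge0_negligible_integral _ _ _ _ _ (~` D))//.
- by rewrite setTD setCK.
- exact: measurableC.
- by have := probability_setC P mD; rewrite PD subee.
Qed.

(* Induction on m with z free replaces the binomial expansion of
   (1 - exp(-cx))^m and its signs: exp(-zx)(1 - exp(-cx))^m is the sum of
   exp(-zx)(1 - exp(-cx))^(m+1) and of exp(-(z+c)x)(1 - exp(-cx))^m, which are
   both nonnegative on D. *)
Let eq_integral_exp_pow c m z : (0 <= c)%R -> (0 <= z)%R ->
  \int[mu]_(x in D) (expR (- (z * x)) * (1 - expR (- (c * x))) ^+ m)%:E =
  \int[nu]_(x in D) (expR (- (z * x)) * (1 - expR (- (c * x))) ^+ m)%:E.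
Proof.
move=> c0; elim: m z => [|m IH] z z0.
  under eq_integral do rewrite expr0 mulr1 -mulNr.
  under [RHS]eq_integral do rewrite expr0 mulr1 -mulNr.
  have mez : measurable_fun [set: measurableTypeR R] (fun x : R => (expR (- z * x))%:E).
    by apply/measurable_EFinP; have := mexp z; under eq_fun do rewrite -mulNr.
  by rewrite -!integral_concentrated ?laplaceE// => x; rewrite lee_fin expR_ge0.
have split (P : probability (measurableTypeR R) R) :
  \int[P]_(x in D) (expR (- (z * x)) * (1 - expR (- (c * x))) ^+ m)%:E =
  \int[P]_(x in D) (expR (- (z * x)) * (1 - expR (- (c * x))) ^+ m.+1)%:E +
  \int[P]_(x in D) (expR (- ((z + c) * x)) * (1 - expR (- (c * x))) ^+ m)%:E.
  rewrite -ge0_integralD//=.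
  - apply: eq_integral => x _; rewrite -EFinD; congr EFin.
    by rewrite mulrDl opprD expRD exprS; ring.
  - by move=> x Dx; rewrite lee_fin exp_pow_ge0.
  - by move=> x Dx; rewrite lee_fin exp_pow_ge0.
have fin (P : probability (measurableTypeR R) R) :
  \int[P]_(x in D) (expR (- ((z + c) * x)) * (1 - expR (- (c * x))) ^+ m)%:E
    \is a fin_num.
  rewrite ge0_fin_numE; last by apply: integral_ge0 => x Dx; rewrite lee_fin exp_pow_ge0.
  apply: (@le_lt_trans _ _ (\int[P]_(x in D) 1)).
    apply: ge0_le_integral => //.
    - by move=> x Dx; rewrite lee_fin exp_pow_ge0.
    - move=> x /D_ge0 x0; rewrite lee_fin.
      have /andP[a0 a1] := expRN_itv (mulr_ge0 (addr_ge0 z0 c0) x0).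
      have /andP[b0 b1] := expRN_itv (mulr_ge0 c0 x0).
      by rewrite mulr_ile1// ?exprn_ge0 ?exprn_ile1 ?subr_ge0// gerBl.
  by rewrite integral_cst// mul1e; exact: le_lt_trans (probability_le1 P mD) (ltry _).
have := IH z z0; rewrite !split (IH _ (addr_ge0 z0 c0)).
by move/(congr1 (fun e => e - \int[nu]_(x in D)
  (expR (- ((z + c) * x)) * (1 - expR (- (c * x))) ^+ m)%:E)); rewrite !addeK.
Qed.

Let eq_ray a : mu `]a, +oo[%classic = nu `]a, +oo[%classic.
Proof.
have cvg_ray (P : probability (measurableTypeR R) R) : P D = 1 ->
    \int[P]_(x in D) (ray_approx a n x)%:E @[n --> \oo] --> P `]a, +oo[%classic.
  move=> PD; have -> : P `]a, +oo[%classic =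
      \int[P]_(x in D) (\1_(`]a, +oo[%classic : set R) x)%:E.
    rewrite -integral_concentrated//; last exact/measurable_EFinP.
    by rewrite integral_indic// setIT.
  apply: (@dominated_cvg _ _ _ P D mD _ _ (cst 1)) => //.
  - move=> n; rewrite (_ : (fun x => _) = (fun x : R => (expR (- (0 * x)) *
      (1 - expR (- (n.+1%:R * x))) ^+ Num.truncn (n.+1%:R * expR (n.+1%:R * a)))%:E))//.
    by apply/funext => x; rewrite mul0r oppr0 expR0 mul1r.
  - move=> x /D_ge0 x0; apply: cvg_EFin; first exact: nearW.
    exact: cvg_ray_approx.
  - by apply/integrableP; split => //; rewrite integral_cst//= normr1 mul1e PD ltry.
  - move=> n x /D_ge0 x0; rewrite lee_fin.
    by have /andP[? ?] := ray_approx_itv a n x0; rewrite ger0_norm.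
apply: (cvg_unique _ (cvg_ray mu muD1)) => //.
rewrite (_ : (fun n => _) = (fun n => \int[nu]_(x in D) (ray_approx a n x)%:E)).
  exact: cvg_ray.
apply/funext => n.
have rayE (P : probability (measurableTypeR R) R) :
    \int[P]_(x in D) (ray_approx a n x)%:E = \int[P]_(x in D) (expR (- (0 * x)) *
      (1 - expR (- (n.+1%:R * x))) ^+ Num.truncn (n.+1%:R * expR (n.+1%:R * a)))%:E.
  by apply: eq_integral => x _; rewrite mul0r oppr0 expR0 mul1r.
by rewrite !rayE eq_integral_exp_pow.
Qed.

(** The rays form a generating class stable under intersection, on which the two
    laws agree as limits of integrals of [ray_approx]. *)
Theorem laplace_injective B : measurable B -> mu B = nu B.
Proof.
move=> mB; apply: (@measure_unique _ _ (measurableTypeR R) (@RGenOInfty.G R)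
  (fun n => `](- n%:R)%R, +oo[%classic) _ _ _ _ mu nu) => //.
- exact: RGenOInfty.measurableE.
- move=> _ _ [x ->] [y ->]; exists (Num.max x y).
  by apply/seteqP; split => u/=; rewrite !in_itv/= !andbT gt_max => /andP.
- by move=> n; eexists.
- apply/seteqP; split => // x _; exists (Num.truncn `|x|).+1 => //=.
  rewrite in_itv/= andbT ltrNl (le_lt_trans _ (truncnS_gt _))//.
  by rewrite -normrN ler_norm.
- by move=> _ [x ->]; exact: eq_ray.
- by move=> n; rewrite (le_lt_trans (probability_le1 _ _)) ?ltry.
Qed.

End determined.
End laplace_uniqueness.

(** * Independence for finite families of events *)

Section independence_tools.
Context d (T : measurableType d) (R : realType) (P : probability T R).

Lemma forall_bigsetI n (A : 'I_n -> set T) :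
  [set w | forall i, A i w] = \big[setI/setT]_(i < n) A i.
Proof.
rewrite -bigcap_seq; apply/seteqP; split => w Aw i; first by move=> _; exact: Aw.
by apply: Aw; rewrite /= mem_index_enum.
Qed.

(** The product rule over finite subfamilies, with the subfamily given as a
    duplicate-free list so that it can be rewritten with the usual lemmas on
    iterated operators. *)
Lemma independent_systems_seq (J : choiceType) (D : set J)
    (F : J -> set (set T)) (s : seq J) (E : J -> set T) :
  independent_systems P D F -> uniq s ->
  (forall j, j \in s -> D j /\ F j (E j)) ->
  P [set w | forall j, j \in s -> E j w] = (\prod_(j <- s) P (E j))%E.
Proof.
move=> indep us FE; have := indep (seq_fset tt s) E.
have -> : \bigcap_(j in [set` seq_fset tt s]) E j = [set w | forall j, j \in s -> E j w].
  apply/seteqP; split => w Ew j js; apply: (Ew j).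
    by move: js; rewrite -(seq_fsetE tt).
  by rewrite -(seq_fsetE tt).
move=> ->; last by move=> j; rewrite seq_fsetE => /FE.
by apply: perm_big; rewrite (perm_trans (seq_fset_perm _ _))// undup_id.
Qed.

Section iid_sequence.
Context d' (T' : measurableType d') (V : nat -> T -> T').
Variables (n : nat) (D : 'I_n -> set T').
Hypothesis mD : forall i, measurable (D i).

Lemma sigma_seq_block : sigma_seq V [set w | forall i : 'I_n, D i (V i.+1 w)].
Proof.
rewrite (forall_bigsetI (fun i => V i.+1 @^-1` D i)).
rewrite /sigma_seq /generated_sigma.
set G := (X in <<s X >>).
apply: (@bigsetI_measurable _ (g_sigma_algebraType G)) => i _.
apply: sub_sigma_algebra; exists i.+1 => //; exists (D i) => //.
by rewrite setTI.
Qed.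

Lemma iid_block : iid P V ->
  P [set w | forall i : 'I_n, D i (V i.+1 w)] =
  (\prod_(i < n) P (V 1%N @^-1` D i))%E.
Proof.
move=> [indep id].
(* The sets D are indexed by 'I_n and the product rule by nat; quantifying over
   the i such that i.+1 = j avoids choosing a default ordinal, which would not
   exist for n = 0. *)
pose E j := [set w | forall i : 'I_n, i.+1 = j -> D i (V j w)].
have ES (i : 'I_n) : E i.+1 = V i.+1 @^-1` D i.
  apply/seteqP; split => w Ew; first exact: Ew.
  by move=> k [] /val_inj ->.
have -> : [set w | forall i : 'I_n, D i (V i.+1 w)] =
    [set w | forall j, j \in [seq i.+1 | i : 'I_n <- index_enum 'I_n] -> E j w].
  apply/seteqP; split => w Dw; first by move=> _ /mapP[i _ ->] k [] /val_inj ->.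
  by move=> i; apply: (Dw i.+1 _ i erefl); apply: map_f; rewrite mem_index_enum.
rewrite (independent_systems_seq indep).
- by rewrite big_map; apply: eq_bigr => i _; rewrite ES (id i.+1 1%N).
- by rewrite map_inj_uniq ?index_enum_uniq// => i j [] /val_inj.
- move=> j /mapP[i _ ->]; rewrite ES; split => //.
  by exists (D i) => //; rewrite setTI.
Qed.
End iid_sequence.
End independence_tools.

(** * Integrals of random variables *)

Section expectation_tools.
Context d (T : measurableType d) (R : realType) (P : probability T R).

Lemma eq_law_integral (U V : {RV P >-> R}) (g : R -> R) :
  (forall C, measurable C -> P (U @^-1` C) = P (V @^-1` C)) ->
  measurable_fun setT g -> (forall x, 0 <= g x) ->
  (\int[P]_w (g (U w))%:E = \int[P]_w (g (V w))%:E)%E.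
Proof.
move=> UV mg g0.
have mgE : measurable_fun setT (EFin \o g) by exact/measurable_EFinP.
have lawE (X : {RV P >-> R}) :
    (\int[P]_w (g (X w))%:E = \int[distribution P X]_y (EFin \o g) y)%E.
  by rewrite ge0_integral_distribution// => y; rewrite lee_fin.
by rewrite !lawE; apply: eq_measure_integral => C mC _; exact: UV.
Qed.

Lemma integral_sqr_Lfun2 (X : T -> R) : measurable_fun setT X ->
  (\int[P]_w (X w ^+ 2)%:E < +oo)%E -> X \in Lfun P 2%:E.
Proof.
move=> mX X2; rewrite inE; apply/andP; split; rewrite inE//=.
rewrite /finite_norm unlock poweR_lty//.
apply: le_lt_trans X2; rewrite le_eqVlt; apply/orP; left; apply/eqP.
by apply: eq_integral => w _ /=; rewrite powR_mulrn// real_normK ?num_real.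
Qed.

Lemma lte_integral_sqr (X : T -> R) : measurable_fun setT X ->
  (\int[P]_w (X w ^+ 2)%:E < +oo -> \int[P]_w `|X w|%:E < +oo)%E.
Proof.
move=> mX X2; apply: (@le_lt_trans _ _ (\int[P]_w (1 + (X w ^+ 2)%:E))%E).
  apply: ge0_le_integral => //.
  - by apply/measurable_EFinP; exact: measurableT_comp.
  - by apply: emeasurable_funD => //; apply/measurable_EFinP; exact: measurable_funX.
  - move=> w _; rewrite -EFinD lee_fin -real_normK ?num_real//.
    by have := sqr_ge0 (`|X w| - 1); have := normr_ge0 (X w); nra.
rewrite ge0_integralD//; last 2 first.
- by move=> w _; rewrite lee_fin sqr_ge0.
- by apply/measurable_EFinP; exact: measurable_funX.
by rewrite lte_add_pinfty// integral_cst// mul1e (le_lt_trans (probability_le1 _ _)) ?ltry.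
Qed.

Lemma ae_ge0_expectation (X : T -> R) : measurable_fun setT X ->
  {ae P, forall w, 0 <= X w} -> 'E_P[X]%E = (\int[P]_w `|X w|%:E)%E.
Proof.
move=> mX X0; rewrite unlock; apply: ae_eq_integral => //.
- exact/measurable_EFinP.
- by apply/measurable_EFinP; exact: measurableT_comp.
- by apply: filterS X0 => w X0 _; rewrite ger0_norm.
Qed.
End expectation_tools.

(** * The law of a jump *)

Section compound.
Context d (T : measurableType d) (R : realType) (P : probability T R).
Variables (lambda lambda0 lambda1 lambda2 : R).
Variables (I1 I2 I0 Y1 Y2 Y3 Y4 : nat -> {RV P >-> R}).
Variable N : R -> {RV P >-> nat}.
Local Notation F0 := (generated_sigma [set t : R | 0 <= t] N).
Hypothesis hN : poisson_process lambda N.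
Hypothesis hI : iid P (fun i w => (I1 i w, I2 i w, I0 i w)).
Hypothesis hI_law : forall i, (1 <= i)%N ->
      [/\ P [set w | (I1 i w, I2 i w, I0 i w) = (1, 0, 0)]
            = (lambda1 / lambda)%:E,
          P [set w | (I1 i w, I2 i w, I0 i w) = (0, 1, 0)]
            = (lambda2 / lambda)%:E &
          P [set w | (I1 i w, I2 i w, I0 i w) = (0, 0, 1)]
            = (lambda0 / lambda)%:E].
Hypothesis hY1 : iid P Y1.
Hypothesis hY2 : iid P Y2.
Hypothesis hY34 : iid P (fun i w => (Y3 i w, Y4 i w)).
Hypothesis hindep : independent_systems P [set: 'I_5] (fun j : 'I_5 =>
      nth set0
        [:: F0; sigma_seq Y1; sigma_seq Y2;
            sigma_seq (fun i w => (Y3 i w, Y4 i w));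
            sigma_seq (fun i w => (I1 i w, I2 i w, I0 i w))] j).

(** The three kinds of claims are numbered 0, 1, 2; the last one is the common
    shock Y3 + Y4.  Kinds are natural numbers, with every number above 1 read as
    2, so that an ordinal in 'I_3 can be used directly and sums over 'I_3 unfold
    by computation. *)
Definition claim (a i : nat) (w : T) : R :=
  match a with 0 => Y1 i w | 1 => Y2 i w | _ => Y3 i w + Y4 i w end.

Lemma measurable_claim a i : measurable_fun setT (claim a i).
Proof. by case: a => [|[|a]] //; exact: measurable_funD. Qed.

HB.instance Definition _ a i :=
  isMeasurableFun.Build _ _ _ _ (claim a i) (measurable_claim a i).

Definition mark (i : nat) (w : T) : R * R * R := (I1 i w, I2 i w, I0 i w).

Definition kind (a : nat) : R * R * R :=
  match a with 0 => (1, 0, 0) | 1 => (0, 1, 0) | _ => (0, 0, 1) end.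

Definition kind_prob (a : nat) : R :=
  match a with
  | 0 => lambda1 / lambda | 1 => lambda2 / lambda | _ => lambda0 / lambda
  end.

Lemma measurable_mark i : measurable_fun setT (mark i).
Proof. by apply: measurable_fun_pair => //; exact: measurable_fun_pair. Qed.

Lemma measurable_kind a : measurable [set kind a].
Proof.
have m3 (x y z : R) : measurable [set (x, y, z)].
  rewrite (_ : [set _] = ([set x] `*` [set y]) `*` [set z]).
    by apply: measurableX => //; exact: measurableX.
  by apply/seteqP; split => [_ ->//|[[x' y'] z'] /= [[-> ->] ->]].
by case: a => [|[|a]] /=; exact: m3.
Qed.

Lemma kind_law a i : (1 <= i)%N -> P [set w | mark i w = kind a] = (kind_prob a)%:E.
Proof. by case: a => [|[|a]] /hI_law[]. Qed.

Lemma claim_law a i C : (1 <= i)%N -> measurable C ->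
  P (claim a i @^-1` C) = P (claim a 1%N @^-1` C).
Proof.
move=> i1 mC; case: a => [|[|a]] /=.
- exact: (hY1.2 i 1%N).
- exact: (hY2.2 i 1%N).
- have mC' : measurable [set p : R * R | C (p.1 + p.2)].
    rewrite -[X in measurable X]setTI.
    apply: (_ : measurable_fun setT (fun p : R * R => p.1 + p.2)) => //.
    exact: measurable_funD.
  exact: (hY34.2 i 1%N i1 isT _ mC').
Qed.

(** For fixed kinds f the event splits into one event per block.  In the block
    of a given sequence, indices of another kind are constrained by the full set
    (sets [on]); they contribute a factor 1, so that all blocks are products over
    the same range and can be merged factor by factor. *)
Lemma block_factorization E0 n (f : 'I_n -> 'I_3) (C : 'I_n -> set R) :
  F0 E0 -> (forall i, measurable (C i)) ->
  (P [set w | [/\ E0 w, forall i : 'I_n, mark i.+1 w = kind (f i) &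
                 forall i : 'I_n, C i (claim (f i) i.+1 w)]] =
  P E0 * \prod_(i < n) ((kind_prob (f i))%:E * P (claim (f i) 1%N @^-1` C i)))%E.
Proof.
move=> FE0 mC.
pose on (a : nat) (i : 'I_n) : set R := if val (f i) == a then C i else setT.
have mon a i : measurable (on a i) by rewrite /on; case: ifP.
pose on34 i : set (R * R) := [set p : R * R | on 2%N i (p.1 + p.2)].
have mon34 i : measurable (on34 i).
  rewrite -[X in measurable X]setTI.
  apply: (_ : measurable_fun setT (fun p : R * R => p.1 + p.2)) => //.
  exact: measurable_funD.
pose E := [:: E0; [set w | forall i : 'I_n, on 0%N i (Y1 i.+1 w)];
  [set w | forall i : 'I_n, on 1%N i (Y2 i.+1 w)];
  [set w | forall i : 'I_n, on34 i (Y3 i.+1 w, Y4 i.+1 w)];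
  [set w | forall i : 'I_n, [set kind (f i)] (mark i.+1 w)]].
(* One event for each of the five blocks, in the order in which the
   independence hypothesis lists them. *)
have -> : [set w | [/\ E0 w, forall i : 'I_n, mark i.+1 w = kind (f i) &
                 forall i : 'I_n, C i (claim (f i) i.+1 w)]] =
   [set w | forall j : 'I_5, j \in index_enum 'I_5 -> nth set0 E j w].
  apply/seteqP; split => w /=.
    move=> [E0w mk cl] [[|[|[|[|[|//]]]]] ? _]//= i; rewrite ?/on34/= /on; case: eqP => // fi.
    - by have := cl i; rewrite fi.
    - by have := cl i; rewrite fi.
    - by have := cl i; rewrite fi.
  move=> Ew; split.
  - exact: (Ew ord0 (mem_index_enum _)).
  - exact: (Ew (@Ordinal 5 4 isT) (mem_index_enum _)).
  - move=> i; have := Ew (@Ordinal 5 1 isT) (mem_index_enum _) i.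
    have := Ew (@Ordinal 5 2 isT) (mem_index_enum _) i.
    have := Ew (@Ordinal 5 3 isT) (mem_index_enum _) i.
    by rewrite /= /on34/= /on; case: (f i) => [[|[|[|//]]]] ? /=.
rewrite (independent_systems_seq hindep) ?index_enum_uniq//; last first.
  move=> [[|[|[|[|[|//]]]]] ?] _; split => //=.
  - exact: sigma_seq_block.
  - exact: sigma_seq_block.
  - exact: (@sigma_seq_block _ _ _ _ (fun i w => (Y3 i w, Y4 i w)) _ on34).
  - exact: (@sigma_seq_block _ _ _ _ mark _ (fun i => [set kind (f i)])
      (fun i => measurable_kind _)).
rewrite !big_ord_recl big_ord0 mule1; congr (_ * _)%E.
transitivity (\prod_(i < n) P (Y1 1%N @^-1` on 0%N i) *
  (\prod_(i < n) P (Y2 1%N @^-1` on 1%N i) *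
  (\prod_(i < n) P ((fun w => (Y3 1%N w, Y4 1%N w)) @^-1` on34 i) *
   \prod_(i < n) P (mark 1%N @^-1` [set kind (f i)]))))%E.
  congr (_ * (_ * (_ * _)))%E.
  - exact: (@iid_block _ _ _ _ _ _ (fun i w => Y1 i w) _ (on 0%N)).
  - exact: (@iid_block _ _ _ _ _ _ (fun i w => Y2 i w) _ (on 1%N)).
  - exact: (@iid_block _ _ _ _ _ _ (fun i w => (Y3 i w, Y4 i w)) _ on34).
  - exact: (@iid_block _ _ _ _ _ _ mark _ (fun i => [set kind (f i)])
      (fun i => measurable_kind (f i))).
rewrite -!big_split/=; apply: eq_bigr => i _.
have -> : P (mark 1%N @^-1` [set kind (f i)]) = (kind_prob (f i))%:E by exact: kind_law.
rewrite /on34 /on; case: (f i) => [[|[|[|//]]]] ? /=.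
all: by rewrite !preimage_setT !probability_setT !mul1e muleC.
Qed.

Hypotheses (hlambda0 : 0 < lambda0) (hlambda1 : 0 < lambda1) (hlambda2 : 0 < lambda2).
Hypothesis hlambda : lambda = lambda0 + lambda1 + lambda2.

Lemma lambda_gt0 : 0 < lambda. Proof. by rewrite hlambda !addr_gt0. Qed.

Lemma kind_prob_ge0 a : 0 <= kind_prob a.
Proof.
by case: a => [|[|a]]; rewrite divr_ge0// ltW// lambda_gt0.
Qed.

Lemma sum_kind_prob : \sum_(a < 3) kind_prob a = 1.
Proof.
rewrite !big_ord_recl big_ord0 addr0/= -!mulrDl.
by rewrite addrA addrC addrA -hlambda divff// gt_eqF// lambda_gt0.
Qed.

Lemma kind_inj (a b : 'I_3) : kind a = kind b -> a = b.
Proof.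
have o : (1 : R) <> 0 by exact/eqP/oner_neq0.
move=> E; apply/val_inj; move: E.
by case: a => [[|[|[|//]]]] ?; case: b => [[|[|[|//]]]] ? //= -[] => // *; exfalso; apply: o.
Qed.

(** The probabilities of the three disjoint events add up to one. *)
Lemma mark_kind : {ae P, forall w, forall i, exists a : 'I_3, mark i.+1 w = kind a}.
Proof.
apply/ae_foralln => i.
pose M (a : 'I_3) := [set w | mark i.+1 w = kind a].
have mM a : measurable (M a).
  have := measurable_mark i.+1 measurableT (measurable_kind a).
  by rewrite setTI.
have mU : measurable (\big[setU/set0]_(a < 3) M a) by exact: bigsetU_measurable.
have PM : P (\big[setU/set0]_(a < 3) M a) = 1%E.
  rewrite measure_bigsetU_ord//; last first.
    apply/trivIsetP => a b _ _ /eqP ab; rewrite -subset0 => w [/= ka kb].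
    by apply: ab; apply: kind_inj; rewrite -ka.
  rewrite (eq_bigr (fun a : 'I_3 => (kind_prob a)%:E)); last by move=> a _; exact: kind_law.
  by rewrite sumEFin sum_kind_prob.
exists (~` \big[setU/set0]_(a < 3) M a); split; first exact: measurableC.
  by have := probability_setC P mU; rewrite PM subee.
move=> w /= nex; rewrite -bigcup_seq => -[a _ Maw]; apply: nex.
by exists a.
Qed.

Definition jump (i : nat) (w : T) : R :=
  I1 i w * Y1 i w + I0 i w * (Y3 i w + Y4 i w) + I2 i w * Y2 i w.

Lemma jump_claim a i w : mark i w = kind a -> jump i w = claim a i w.
Proof.
rewrite /jump; case: a => [|[|a]] [-> -> ->] /=;
  by rewrite !(mul1r, mul0r, add0r, addr0).
Qed.

Lemma measurable_jump i : measurable_fun setT (jump i).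
Proof.
by apply: measurable_funD; [apply: measurable_funD|]; apply: measurable_funM => //;
  exact: measurable_funD.
Qed.

(** Almost surely exactly one assignment f agrees with all the marks, so the
    product over the jumps is the sum over all f of the products over the claims
    of kinds f, each restricted to the event that the marks follow f.  The
    integral of each summand is a product by independence, and
    [bigA_distr_bigA] turns the sum of these products into a product of sums.
    The expectations m are real numbers so that this distributivity is used in
    a ring. *)
Lemma jump_factorization E0 n (g : 'I_n -> R -> R) (m : 'I_n -> 'I_3 -> R) :
  F0 E0 -> measurable E0 ->
  (forall i, measurable_fun setT (g i)) -> (forall i x, 0 <= g i x) ->
  (forall i (a : 'I_3), \int[P]_w (g i (claim a 1%N w))%:E = (m i a)%:E)%E ->
  (\int[P]_(w in E0) (\prod_(i < n) g i (jump i.+1 w))%:E =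
   P E0 * (\prod_(i < n) \sum_(a < 3) kind_prob a * m i a)%:E)%E.
Proof.
move=> FE0 mE0 mg g0 gm.
pose h (f : {ffun 'I_n -> 'I_3}) w : \bar R :=
  (\prod_(i < n) (g i (claim (f i) i.+1 w))%:E)%E.
pose M (f : {ffun 'I_n -> 'I_3}) := [set w | forall i : 'I_n, mark i.+1 w = kind (f i)].
have mM f : measurable (M f).
  rewrite /M (forall_bigsetI (fun i : 'I_n => mark i.+1 @^-1` [set kind (f i)])).
  apply: bigsetI_measurable => i _; rewrite -[X in measurable X]setTI.
  exact: measurable_mark measurableT _ (measurable_kind _).
have mh f : measurable_fun setT (h f).
  rewrite /h; under eq_fun do rewrite prodEFin.
  apply/measurable_EFinP; apply: measurable_prod => i _.
  exact: measurableT_comp (mg i) (measurable_claim _ _).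
have mhM f : measurable_fun setT (h f \_ (M f)).
  by apply/(measurable_restrictT _ _).1 => //; exact: measurable_funTS.
have h0 f w : (0 <= h f w)%E by rewrite prode_ge0// => i _; rewrite lee_fin.
transitivity (\int[P]_(w in E0) (\sum_f (h f \_ (M f)) w))%E.
  apply: ge0_ae_eq_integral => //.
  - apply: measurable_funTS; apply/measurable_EFinP; apply: measurable_prod => i _.
    exact: measurableT_comp (mg i) (measurable_jump _).
  - by apply: measurable_funTS; exact: emeasurable_sum.
  - by move=> w _; rewrite lee_fin prodr_ge0.
  - by move=> w _; apply: sume_ge0 => f _; exact: erestrict_ge0.
  apply: filterS mark_kind => w mk _.
  have [k hk] := choice mk; pose f := [ffun i : 'I_n => k i].
  have Mf : M f w by move=> i; rewrite ffunE.
  rewrite (bigD1 f)//= patchE mem_set// [X in (_ + X)%E]big1 ?adde0.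
    rewrite /= /h prodEFin; congr EFin; apply: eq_bigr => i _.
    by rewrite (jump_claim (Mf i)).
  move=> f' /eqP ff'; rewrite patchE memNset// => Mf'; apply: ff'.
  by apply/ffunP => i; apply: kind_inj; rewrite -(Mf i) -(Mf' i).
rewrite ge0_integral_sum//; last 2 first.
- by move=> f; exact: measurable_funTS.
- by move=> f w _; exact: erestrict_ge0.
have claimE (f : {ffun 'I_n -> 'I_3}) i :
    (\int[P]_w (g i (claim (f i) i.+1 w))%:E = (m i (f i))%:E)%E.
  rewrite -gm; apply: (@eq_law_integral _ _ _ _ (claim (f i) i.+1) (claim (f i) 1%N)) => //.
  by move=> C mC; exact: claim_law.
have PM (f : {ffun 'I_n -> 'I_3}) (C : 'I_n -> set R) : (forall i, measurable (C i)) ->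
   (P (E0 `&` M f `&` \big[setI/setT]_(i < n) (claim (f i) i.+1 @^-1` C i)) =
    P E0 * \prod_(i < n) ((kind_prob (f i))%:E * P (claim (f i) i.+1 @^-1` C i)))%E.
  move=> mC; rewrite -forall_bigsetI.
  under eq_bigr => i _ do rewrite claim_law//.
  rewrite -(block_factorization f FE0 mC); congr (P _).
  by apply/seteqP; split => w; [move=> [[]] | move=> []].
have PMT (f : {ffun 'I_n -> 'I_3}) :
    (P (E0 `&` M f) = P E0 * \prod_(i < n) (kind_prob (f i))%:E)%E.
  have := PM f (fun=> setT) (fun=> measurableT).
  rewrite big1 ?setIT// => ->; congr (_ * _)%E; apply: eq_bigr => i _.
  by rewrite preimage_setT probability_setT mule1.
rewrite (eq_bigr (fun f : {ffun 'I_n -> 'I_3} => P E0 *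
    (\prod_(i < n) (kind_prob (f i) * m i (f i)))%:E)%E); last first.
  move=> f _; rewrite -integral_mkcondr.
  rewrite (@ge0_integral_prod_indep _ _ _ _ _ _ (fun i => g i \o claim (f i) i.+1))//.
  - rewrite PMT -muleA -big_split/= -prodEFin; congr (_ * _)%E.
    by apply: eq_bigr => i _; rewrite claimE EFinM.
  - exact: index_enum_uniq.
  - exact: measurableI.
  - by move=> i; exact: measurableT_comp (mg i) (measurable_claim _ _).
  - by move=> i w; exact: g0.
  - move=> B mB; rewrite PMT -muleA -big_split/=.
    apply: (PM f (fun i => g i @^-1` B i)) => i.
    by rewrite -[X in measurable X]setTI; exact: mg.
have m0 i a : 0 <= m i a.
  by rewrite -lee_fin -gm; apply: integral_ge0 => w _; rewrite lee_fin.
rewrite bigA_distr_bigA/= -sumEFin ge0_sume_distrr// => f _.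
by rewrite lee_fin prodr_ge0// => i _; rewrite mulr_ge0// kind_prob_ge0.
Qed.

(** * The transform and the first two moments of the compound sum *)

Lemma count_law t k : 0 <= t ->
  P (N t @^-1` [set k]) = (poisson_weight (lambda * t) k)%:E.
Proof.
rewrite le_eqVlt => /predU1P[<-|t0].
  rewrite mulr0 /poisson_weight /exp_coeff/= oppr0 expR0 mulr1.
  have [->|k0] := eqVneq k 0%N.
    rewrite expr0 fact0 divr1 (_ : _ @^-1` _ = setT) ?probability_setT//.
    by apply/seteqP; split => // w _ /=; rewrite (poisson_start hN).
  rewrite expr0n (negbTE k0) mul0r (_ : _ @^-1` _ = set0) ?measure0//.
  rewrite -subset0 => w /=; rewrite (poisson_start hN) => k0'.
  by rewrite -k0' eqxx in k0.
have := poisson_increments hN k (lexx 0) t0.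
rewrite subr0 (_ : [set w | _] = N t @^-1` [set k]).
  by move=> ->; rewrite /poisson_pmf mulr_gt0 ?lambda_gt0.
by apply/seteqP; split => w /=; rewrite (poisson_start hN) subn0.
Qed.

Lemma measurable_count t k : measurable (N t @^-1` [set k]).
Proof. by rewrite -[X in measurable X]setTI; exact: measurable_funP. Qed.

Lemma count_system t k : 0 <= t -> F0 (N t @^-1` [set k]).
Proof.
move=> t0; apply: sub_sigma_algebra; exists t => //; exists [set k] => //.
by rewrite setTI.
Qed.

Lemma integral_count t (h : T -> \bar R) : measurable_fun setT h ->
  (forall w, 0 <= h w)%E ->
  (\int[P]_w h w = \sum_(0 <= k <oo) \int[P]_(w in N t @^-1` [set k]) h w)%E.
Proof.
move=> mh h0; have NT : \bigcup_k (N t @^-1` [set k]) = setT.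
  by apply/seteqP; split => // w _; exists (N t w).
rewrite -ge0_integral_bigcup ?NT//; first by move=> k; exact: measurable_count.
by apply/trivIsetP => i j _ _ /eqP ij; rewrite -subset0 => w [/= -> /ij].
Qed.

Let S := compound_sum N I1 I2 I0 Y1 Y2 Y3 Y4.

Lemma compound_sumE t k w : N t w = k -> S t w = \sum_(i < k) jump i.+1 w.
Proof. by move=> <-; rewrite /S /compound_sum big_add1 big_mkord. Qed.

Lemma compound_laplace t z (L : 'I_3 -> R) : 0 <= t ->
  (forall a : 'I_3, \int[P]_w (expR (- z * claim a 1%N w))%:E = (L a)%:E)%E ->
  (\int[P]_w (expR (- z * S t w))%:E =
   (expR (- (lambda * t * (1 - \sum_(a < 3) kind_prob a * L a))))%:E)%E.
Proof.
move=> t0 hL; have r0 : 0 <= lambda * t by rewrite mulr_ge0// ltW// lambda_gt0.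
have mexp : measurable_fun setT (fun x : R => expR (- z * x)).
  by apply: (measurableT_comp (@measurable_expR R)); exact: measurable_funM.
have L0 a : 0 <= L a.
  by rewrite -lee_fin -hL; apply: integral_ge0 => w _; rewrite lee_fin expR_ge0.
rewrite -poisson_pgf//; last first.
  by apply: sumr_ge0 => a _; rewrite mulr_ge0// kind_prob_ge0.
rewrite (integral_count t); last 2 first.
- apply/measurable_EFinP.
  exact: (measurableT_comp mexp (measurable_compound_sum N I1 I2 I0 Y1 Y2 Y3 Y4 t)).
- by move=> w; rewrite lee_fin expR_ge0.
apply: eq_eseriesr => k _.
transitivity (\int[P]_(w in N t @^-1` [set k])
    (\prod_(i < k) expR (- z * jump i.+1 w))%:E)%E.
  apply: eq_integral => w /[!inE]/= Nk; congr EFin.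
  by rewrite (compound_sumE Nk) mulr_sumr expR_sum.
rewrite (@jump_factorization _ k (fun _ x => expR (- z * x)) (fun=> L))//.
- by rewrite count_law// -EFinM prodr_const card_ord.
- exact: count_system.
- exact: measurable_count.
Qed.

Lemma jump_moment t k (i : 'I_k) (phi : R -> R) (m : 'I_3 -> R) : 0 <= t ->
  measurable_fun setT phi -> (forall x, 0 <= phi x) ->
  (forall a : 'I_3, \int[P]_w (phi (claim a 1%N w))%:E = (m a)%:E)%E ->
  (\int[P]_(w in N t @^-1` [set k]) (phi (jump i.+1 w))%:E =
   (poisson_weight (lambda * t) k * \sum_(a < 3) kind_prob a * m a)%:E)%E.
Proof.
move=> t0 mphi phi0 phim.
have := @jump_factorization (N t @^-1` [set k]) k
  (fun j x => if j == i then phi x else 1) (fun j a => if j == i then m a else 1).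
rewrite count_law// -EFinM (bigD1 i)//= eqxx.
rewrite [X in (_ * (_ * X))%:E]big1 ?mulr1; last first.
  move=> j /negbTE ->; under eq_bigr do rewrite mulr1; exact: sum_kind_prob.
move=> <-.
- apply: eq_integral => w _; congr EFin; rewrite (bigD1 i)//= eqxx big1 ?mulr1//.
  by move=> j /negbTE ->.
- exact: count_system.
- exact: measurable_count.
- by move=> j; case: eqP.
- by move=> j x; case: eqP.
- move=> j a; case: eqP => // _.
  by rewrite integral_cst// mul1e; exact: probability_setT.
Qed.

(** Together with [jump_moment], this evaluates the diagonal and off-diagonal
    terms of the square of a sum of jumps. *)
Lemma jump_mixed_moment t k (i j : 'I_k) (phi : R -> R) (m : 'I_3 -> R) :
  0 <= t -> i != j -> measurable_fun setT phi -> (forall x, 0 <= phi x) ->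
  (forall a : 'I_3, \int[P]_w (phi (claim a 1%N w))%:E = (m a)%:E)%E ->
  (\int[P]_(w in N t @^-1` [set k]) (phi (jump i.+1 w) * phi (jump j.+1 w))%:E =
   (poisson_weight (lambda * t) k * (\sum_(a < 3) kind_prob a * m a) ^+ 2)%:E)%E.
Proof.
move=> t0 ij mphi phi0 phim.
have := @jump_factorization (N t @^-1` [set k]) k
  (fun l x => if (l == i) || (l == j) then phi x else 1)
  (fun l a => if (l == i) || (l == j) then m a else 1).
rewrite count_law// -EFinM (bigD1 i)//= eqxx (bigD1 j) 1?eq_sym//= eqxx orbT.
rewrite [X in (_ * (_ * (_ * X)))%:E]big1 ?mulr1; last first.
  move=> l /andP[/negbTE -> /negbTE ->] /=.
  by under eq_bigr do rewrite mulr1; exact: sum_kind_prob.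
rewrite expr2; move=> <-.
- apply: eq_integral => w _; congr EFin.
  rewrite (bigD1 i)//= eqxx (bigD1 j) 1?eq_sym//= eqxx orbT big1 ?mulr1//.
  by move=> l /andP[/negbTE -> /negbTE ->].
- exact: count_system.
- exact: measurable_count.
- by move=> l; case: (_ || _).
- by move=> l x; case: ifP.
- move=> l a; case: (_ || _) => //.
  by rewrite integral_cst// mul1e; exact: probability_setT.
Qed.

Hypothesis hY_pos : forall i, (1 <= i)%N ->
  {ae P, forall w, [/\ 0 < Y1 i w, 0 < Y2 i w, 0 < Y3 i w & 0 < Y4 i w]}.

Lemma claim_ge0 a : {ae P, forall w, forall i, 0 <= claim a i.+1 w}.
Proof.
apply/ae_foralln => i; apply: filterS (hY_pos (ltn0Sn i)) => w [y1 y2 y3 y4].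
by case: a => [|[|a]] /=; rewrite ltW// addr_gt0.
Qed.

Lemma jump_ge0 : {ae P, forall w, forall i, 0 <= jump i.+1 w}.
Proof.
have c (a : 'I_3) := claim_ge0 a.
apply: filterS3 mark_kind (c ord0) (filterI (c (@Ordinal 3 1 isT)) (c (@Ordinal 3 2 isT))).
move=> w mk c0 [c1 c2] i; have [a ma] := mk i; rewrite (jump_claim ma).
by case: a {ma} => [[|[|[|//]]]] ? /=; [exact: c0|exact: c1|exact: c2].
Qed.

Lemma compound_sum_ge0 t : {ae P, forall w, 0 <= S t w}.
Proof.
apply: filterS jump_ge0 => w j0.
by rewrite (compound_sumE erefl); apply: sumr_ge0 => i _.
Qed.

Lemma measurable_compound t : measurable_fun setT (S t).
Proof. exact: measurable_compound_sum. Qed.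

Lemma compound_abs_moment t (m : 'I_3 -> R) : 0 <= t ->
  (forall a : 'I_3, \int[P]_w (`|claim a 1%N w|)%:E = (m a)%:E)%E ->
  (\int[P]_w `|S t w|%:E = (lambda * t * \sum_(a < 3) kind_prob a * m a)%:E)%E.
Proof.
move=> t0 hm; have r0 : 0 <= lambda * t by rewrite mulr_ge0// ltW// lambda_gt0.
set M := \sum_(a < 3) _.
rewrite (integral_count t); last 2 first.
- by apply/measurable_EFinP; apply: measurableT_comp => //; exact: measurable_compound.
- by move=> w; rewrite lee_fin.
rewrite mulrC EFinM -(poisson_mean r0) -nneseriesZl; last first.
  by move=> k _; rewrite lee_fin mulr_ge0// poisson_weight_ge0.
apply: eq_eseriesr => k _.
transitivity (\int[P]_(w in N t @^-1` [set k]) (\sum_(i < k) `|jump i.+1 w|%:E))%E.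
  have mj i : measurable_fun (N t @^-1` [set k]) (fun w => `|jump i w|%:E).
    apply: measurable_funTS; apply/measurable_EFinP; apply: measurableT_comp => //.
    exact: measurable_jump.
  apply: ge0_ae_eq_integral => //.
  - exact: measurable_count.
  - by apply: measurable_funTS; apply/measurable_EFinP; apply: measurableT_comp.
  - by apply: emeasurable_sum => i; exact: mj.
  - by move=> w _; apply: sume_ge0 => i _; rewrite lee_fin.
  apply: filterS jump_ge0 => w j0 /= Nk.
  rewrite sumEFin (compound_sumE Nk) ger0_norm; last by apply: sumr_ge0 => i _.
  by congr EFin; apply: eq_bigr => i _; rewrite ger0_norm.
rewrite ge0_integral_sum//; last 2 first.
- exact: measurable_count.
- move=> i; apply: measurable_funTS; apply/measurable_EFinP; apply: measurableT_comp => //.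
  exact: measurable_jump.
rewrite (eq_bigr (fun=> (poisson_weight (lambda * t) k * M)%:E)); last first.
  by move=> i _; rewrite (@jump_moment t k i (fun x => `|x|) m).
rewrite sumEFin sumr_const card_ord -EFinM; congr EFin.
by rewrite -mulr_natr; ring.
Qed.

(** On N(t) = k the square of the sum has k diagonal terms, each contributing
    the second moment Q of a jump, and k(k - 1) off-diagonal ones, each
    contributing the square of its mean M. *)
Lemma compound_second_moment t (m q : 'I_3 -> R) : 0 <= t ->
  (forall a : 'I_3, \int[P]_w (`|claim a 1%N w|)%:E = (m a)%:E)%E ->
  (forall a : 'I_3, \int[P]_w (claim a 1%N w ^+ 2)%:E = (q a)%:E)%E ->
  (\int[P]_w (S t w ^+ 2)%:E = (lambda * t * (\sum_(a < 3) kind_prob a * q a) +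
     (lambda * t * \sum_(a < 3) kind_prob a * m a) ^+ 2)%:E)%E.
Proof.
move=> t0 hm hq; have r0 : 0 <= lambda * t by rewrite mulr_ge0// ltW// lambda_gt0.
set M := \sum_(a < 3) kind_prob a * m a; set Q := \sum_(a < 3) _.
have Q0 : 0 <= Q.
  apply: sumr_ge0 => a _; rewrite mulr_ge0 ?kind_prob_ge0//.
  by rewrite -lee_fin -hq; apply: integral_ge0 => w _; rewrite lee_fin sqr_ge0.
rewrite (integral_count t); last 2 first.
- by apply/measurable_EFinP; apply: measurable_funX; exact: measurable_compound.
- by move=> w; rewrite lee_fin sqr_ge0.
set r := lambda * t.
have w0 k : 0 <= poisson_weight r k by exact: poisson_weight_ge0.
transitivity (\sum_(0 <= k <oo) (Q%:E * (poisson_weight r k * k%:R)%:E +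
    (M ^+ 2)%:E * (poisson_weight r k * (k%:R * k.-1%:R))%:E))%E; last first.
  rewrite nneseriesD; last 2 first.
  - by move=> k _ _; rewrite -EFinM lee_fin mulr_ge0// (mulr_ge0 (w0 k)).
  - by move=> k _ _; rewrite -EFinM lee_fin mulr_ge0 ?sqr_ge0// (mulr_ge0 (w0 k))// mulr_ge0.
  rewrite !nneseriesZl; last 2 first.
  - by move=> k _; rewrite lee_fin (mulr_ge0 (w0 k))// mulr_ge0.
  - by move=> k _; rewrite lee_fin (mulr_ge0 (w0 k)).
  rewrite poisson_mean// poisson_factorial_moment2// -!EFinM -EFinD; congr EFin.
  by ring.
apply: eq_eseriesr => k _.
have mj i : measurable_fun setT (fun w => `|jump i w|).
  by apply: measurableT_comp => //; exact: measurable_jump.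
transitivity (\int[P]_(w in N t @^-1` [set k])
    (\sum_(i < k) \sum_(j < k) (`|jump i.+1 w| * `|jump j.+1 w|)%:E))%E.
  have mjj : measurable_fun setT
      (fun w => \sum_(i < k) \sum_(j < k) `|jump i.+1 w| * `|jump j.+1 w|).
    by apply: measurable_sum => i; apply: measurable_sum => j; exact: measurable_funM.
  rewrite [RHS](eq_integral (fun w =>
      (\sum_(i < k) \sum_(j < k) `|jump i.+1 w| * `|jump j.+1 w|)%:E)); last first.
    by move=> w _; rewrite -sumEFin; apply: eq_bigr => i _; rewrite -sumEFin.
  apply: ge0_ae_eq_integral => //.
  - exact: measurable_count.
  - apply: measurable_funTS; apply/measurable_EFinP; apply: measurable_funX.
    exact: measurable_compound.
  - by apply: measurable_funTS; exact/measurable_EFinP.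
  - by move=> w _; rewrite lee_fin sqr_ge0.
  - move=> w _; rewrite lee_fin; apply: sumr_ge0 => i _; apply: sumr_ge0 => j _.
    exact: mulr_ge0.
  apply: filterS jump_ge0 => w j0 /= Nk; congr EFin.
  rewrite (compound_sumE Nk) expr2 mulr_suml; apply: eq_bigr => i _.
  rewrite mulr_sumr; apply: eq_bigr => j _.
  by rewrite !ger0_norm.
rewrite ge0_integral_sum//; last 3 first.
- exact: measurable_count.
- move=> i; apply: measurable_funTS; apply: emeasurable_sum => j.
  by apply/measurable_EFinP; exact: measurable_funM.
- by move=> i w _; apply: sume_ge0 => j _; rewrite lee_fin mulr_ge0.
rewrite (eq_bigr (fun=> (poisson_weight r k * (Q + k.-1%:R * M ^+ 2))%:E)); last first.
  move=> i _; rewrite ge0_integral_sum//; last 2 first.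
  - exact: measurable_count.
  - by move=> j; apply: measurable_funTS; apply/measurable_EFinP; exact: measurable_funM.
  rewrite (bigD1 i)//= (eq_bigr (fun=> (poisson_weight r k * M ^+ 2)%:E)); last first.
    by move=> j ji; rewrite (@jump_mixed_moment t k i j (fun x => `|x|) m)// eq_sym.
  under eq_integral do rewrite -expr2 real_normK ?num_real//.
  rewrite (@jump_moment t k i (fun x => x ^+ 2) q)//; last by move=> x; rewrite sqr_ge0.
  rewrite sumEFin sumr_const cardC1 card_ord -EFinD; congr EFin.
  by rewrite -mulr_natr mulrDr; congr (_ + _); ring.
rewrite sumEFin sumr_const card_ord -!EFinM -EFinD; congr EFin.
by rewrite -mulr_natr; ring.
Qed.

Local Open Scope ereal_scope.

Lemma claim1_ge0 a : {ae P, forall w, (0 <= claim a 1%N w)%R}.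
Proof. by apply: filterS (claim_ge0 a) => w /(_ 0%N). Qed.

Lemma claim_laplace_fin_num a z : (0 <= z)%R ->
  \int[P]_w (expR (- z * claim a 1%N w))%:E \is a fin_num.
Proof.
move=> z0; rewrite ge0_fin_numE; last by apply: integral_ge0 => w _; rewrite lee_fin expR_ge0.
apply: (@le_lt_trans _ _ (\int[P]_w 1)).
  apply: ae_ge0_le_integral => //.
  - apply/measurable_EFinP; apply: (measurableT_comp (@measurable_expR R)).
    by apply: measurable_funM => //; exact: measurable_claim.
  - apply: filterS (claim1_ge0 a) => w c0 _.
    by rewrite lee_fin -expR0 ler_expR mulNr oppr_le0 mulr_ge0.
by rewrite integral_cst// mul1e; rewrite (le_lt_trans (probability_le1 _ _)) ?ltry.
Qed.

Lemma compound_laplace_formula t z : (0 <= t)%R -> (0 <= z)%R ->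
  'E_P[fun w => (expR (- z * S t w))%R] =
  expeR (- (lambda * t)%:E *
      (1 - (lambda1 / lambda)%:E * 'E_P[fun w => (expR (- z * Y1 1%N w))%R]
         - (lambda0 / lambda)%:E *
             'E_P[fun w => (expR (- z * (Y3 1%N w + Y4 1%N w)))%R]
         - (lambda2 / lambda)%:E * 'E_P[fun w => (expR (- z * Y2 1%N w))%R])).
Proof.
move=> t0 z0; pose L a := fine (\int[P]_w (expR (- z * claim a 1%N w))%:E).
have LE a : \int[P]_w (expR (- z * claim a 1%N w))%:E = (L a)%:E.
  by rewrite fineK//; exact: claim_laplace_fin_num.
rewrite unlock (compound_laplace t0 (fun a => LE a)).
rewrite (LE 0%N) (LE 1%N) (LE 2%N) -!EFinM/=.
congr (expR _)%:E; rewrite !big_ord_recl big_ord0 /=; ring.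
Qed.

Lemma claim2_mean : \int[P]_w `|claim 2%N 1%N w|%:E = 'E_P[Y3 1%N] + 'E_P[Y4 1%N].
Proof.
have pos := hY_pos (leqnn 1).
rewrite !ae_ge0_expectation//; last 2 first.
- by apply: filterS pos => w [_ _ _ /ltW].
- by apply: filterS pos => w [_ _ /ltW].
rewrite -ge0_integralD//; last 2 first.
- by apply/measurable_EFinP; exact: measurableT_comp.
- by apply/measurable_EFinP; exact: measurableT_comp.
apply: ge0_ae_eq_integral => //.
- by apply/measurable_EFinP; apply: measurableT_comp => //; exact: measurable_claim.
- by apply: emeasurable_funD; apply/measurable_EFinP; exact: measurableT_comp.
- by move=> w _; rewrite adde_ge0.
- apply: filterS pos => w [_ _ y3 y4] _ /=.
  by rewrite -EFinD !ger0_norm ?addr_ge0 ?ltW.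
Qed.

Lemma claim_mean a : \int[P]_w `|claim a 1%N w|%:E =
  match a with 0%N => 'E_P[Y1 1%N] | 1%N => 'E_P[Y2 1%N]
  | _ => 'E_P[Y3 1%N] + 'E_P[Y4 1%N] end.
Proof.
have pos := hY_pos (leqnn 1).
case: a => [|[|a]] /=; last exact: claim2_mean.
- by rewrite ae_ge0_expectation//; apply: filterS pos => w [/ltW].
- by rewrite ae_ge0_expectation//; apply: filterS pos => w [_ /ltW].
Qed.

Lemma compound_mean_formula t : (0 <= t)%R ->
  'E_P[Y1 1%N] < +oo -> 'E_P[Y2 1%N] < +oo ->
  'E_P[Y3 1%N] < +oo -> 'E_P[Y4 1%N] < +oo ->
  'E_P[S t] = t%:E * (lambda1%:E * 'E_P[Y1 1%N]
                    + lambda0%:E * ('E_P[Y3 1%N] + 'E_P[Y4 1%N])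
                    + lambda2%:E * 'E_P[Y2 1%N]).
Proof.
move=> t0 e1 e2 e3 e4; pose m a := fine (\int[P]_w `|claim a 1%N w|%:E).
have mE a : \int[P]_w `|claim a 1%N w|%:E = (m a)%:E.
  rewrite fineK// ge0_fin_numE; last by apply: integral_ge0 => w _; rewrite lee_fin.
  by rewrite claim_mean; case: a => [|[|a]] //; rewrite lte_add_pinfty.
have -> : 'E_P[S t] = \int[P]_w `|S t w|%:E.
  apply: ae_ge0_expectation; first exact: measurable_compound.
  exact: compound_sum_ge0.
rewrite (compound_abs_moment t0 (fun a => mE a)).
move: (mE 0%N) (mE 1%N) (mE 2%N); rewrite !claim_mean => -> -> ->.
rewrite -!EFinM; congr EFin.
have l0 : lambda != 0%R by rewrite gt_eqF// lambda_gt0.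
by rewrite !big_ord_recl big_ord0 /=; field.
Qed.

Lemma claim_sqr_lty a :
  'E_P[fun w => (Y1 1%N w ^+ 2)%R] < +oo -> 'E_P[fun w => (Y2 1%N w ^+ 2)%R] < +oo ->
  'E_P[fun w => (Y3 1%N w ^+ 2)%R] < +oo -> 'E_P[fun w => (Y4 1%N w ^+ 2)%R] < +oo ->
  \int[P]_w (claim a 1%N w ^+ 2)%:E < +oo.
Proof.
rewrite unlock => e1 e2 e3 e4; case: a => [|[|a]] //=.
have m3 : measurable_fun setT (fun w => (Y3 1%N w ^+ 2)%:E).
  by apply/measurable_EFinP; exact: measurable_funX.
have m4 : measurable_fun setT (fun w => (Y4 1%N w ^+ 2)%:E).
  by apply/measurable_EFinP; exact: measurable_funX.
apply: (@le_lt_trans _ _ (\int[P]_w (2%:E * ((Y3 1%N w ^+ 2)%:E + (Y4 1%N w ^+ 2)%:E)))).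
  apply: ge0_le_integral => //.
  - by move=> w _; rewrite lee_fin sqr_ge0.
  - by apply/measurable_EFinP; apply: measurable_funX; exact: measurable_funD.
  - by apply: emeasurable_funM => //; exact: emeasurable_funD.
  - move=> w _; rewrite -EFinD -EFinM lee_fin.
    by have := sqr_ge0 (Y3 1%N w - Y4 1%N w); nra.
rewrite ge0_integralZl//; last 2 first.
- exact: emeasurable_funD.
- by move=> w _; rewrite adde_ge0// lee_fin sqr_ge0.
rewrite ge0_integralD//; last 2 first.
- by move=> w _; rewrite lee_fin sqr_ge0.
- by move=> w _; rewrite lee_fin sqr_ge0.
by rewrite lte_mul_pinfty// lte_add_pinfty.
Qed.

Lemma compound_variance_formula t : (0 <= t)%R ->
  'E_P[fun w => (Y1 1%N w ^+ 2)%R] < +oo ->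
  'E_P[fun w => (Y2 1%N w ^+ 2)%R] < +oo ->
  'E_P[fun w => (Y3 1%N w ^+ 2)%R] < +oo ->
  'E_P[fun w => (Y4 1%N w ^+ 2)%R] < +oo ->
  'V_P[S t] = t%:E * (lambda1%:E * 'E_P[fun w => (Y1 1%N w ^+ 2)%R]
                    + lambda0%:E * 'E_P[fun w => ((Y3 1%N w + Y4 1%N w) ^+ 2)%R]
                    + lambda2%:E * 'E_P[fun w => (Y2 1%N w ^+ 2)%R]).
Proof.
move=> t0 e1 e2 e3 e4.
have q_lty a := claim_sqr_lty a e1 e2 e3 e4.
pose q a := fine (\int[P]_w (claim a 1%N w ^+ 2)%:E).
have qE a : \int[P]_w (claim a 1%N w ^+ 2)%:E = (q a)%:E.
  rewrite fineK// ge0_fin_numE ?q_lty//.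
  by apply: integral_ge0 => w _; rewrite lee_fin sqr_ge0.
pose m a := fine (\int[P]_w `|claim a 1%N w|%:E).
have mE a : \int[P]_w `|claim a 1%N w|%:E = (m a)%:E.
  rewrite fineK// ge0_fin_numE; last by apply: integral_ge0 => w _; rewrite lee_fin.
  by apply: lte_integral_sqr; [exact: measurable_claim|exact: q_lty].
have S2 := compound_second_moment t0 (fun a => mE a) (fun a => qE a).
have ES : 'E_P[S t] = (lambda * t * \sum_(a < 3) kind_prob a * m a)%:E.
  rewrite -(compound_abs_moment t0 (fun a => mE a)).
  apply: ae_ge0_expectation; first exact: measurable_compound.
  exact: compound_sum_ge0.
rewrite varianceE; last first.
  by apply: integral_sqr_Lfun2; [exact: measurable_compound|rewrite S2 ltry].
rewrite ES [X in X - _](_ : _ = \int[P]_w (S t w ^+ 2)%:E); last by rewrite unlock.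
rewrite S2 [@expectation]unlock (qE 0%N) (qE 1%N) (qE 2%N).
rewrite expe2 -!EFinM; congr EFin.
have l0 : lambda != 0%R by rewrite gt_eqF// lambda_gt0.
by rewrite [in LHS]expr2 addrK !big_ord_recl big_ord0 /=; field.
Qed.

End compound.

Theorem corollary2 (d : measure_display) (T : measurableType d) (R : realType)
    (P : probability T R)
    (lambda lambda0 lambda1 lambda2 : R)
    (hlambda0 : 0 < lambda0) (hlambda1 : 0 < lambda1) (hlambda2 : 0 < lambda2)
    (hlambda : lambda = lambda0 + lambda1 + lambda2)
    (N : R -> {RV P >-> nat})
    (I1 I2 I0 Y1 Y2 Y3 Y4 : nat -> {RV P >-> R})
    (hN : poisson_process lambda N)
    (hI : iid P (fun i w => (I1 i w, I2 i w, I0 i w)))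
    (hI_law : forall i, (1 <= i)%N ->
      [/\ P [set w | (I1 i w, I2 i w, I0 i w) = (1, 0, 0)]
            = (lambda1 / lambda)%:E,
          P [set w | (I1 i w, I2 i w, I0 i w) = (0, 1, 0)]
            = (lambda2 / lambda)%:E &
          P [set w | (I1 i w, I2 i w, I0 i w) = (0, 0, 1)]
            = (lambda0 / lambda)%:E])
    (hY1 : iid P Y1) (hY2 : iid P Y2) (hY3 : iid P Y3) (hY4 : iid P Y4)
    (hY34 : iid P (fun i w => (Y3 i w, Y4 i w)))
    (hY_pos : forall i, (1 <= i)%N ->
      {ae P, forall w, [/\ 0 < Y1 i w, 0 < Y2 i w, 0 < Y3 i w & 0 < Y4 i w]})
    (hindep : independent_systems P [set: 'I_5] (fun j : 'I_5 =>
      nth set0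
        [:: generated_sigma [set t : R | 0 <= t] N;
            sigma_seq Y1;
            sigma_seq Y2;
            sigma_seq (fun i w => (Y3 i w, Y4 i w));
            sigma_seq (fun i w => (I1 i w, I2 i w, I0 i w))] j))
    (t : R) (ht : 0 <= t) :
  let S := compound_sum N I1 I2 I0 Y1 Y2 Y3 Y4 in
  let LST (z : R) : \bar R :=
    expeR (- (lambda * t)%:E *
      (1 - (lambda1 / lambda)%:E * 'E_P[fun w => (expR (- z * Y1 1%N w))%R]
         - (lambda0 / lambda)%:E *
             'E_P[fun w => (expR (- z * (Y3 1%N w + Y4 1%N w)))%R]
         - (lambda2 / lambda)%:E * 'E_P[fun w => (expR (- z * Y2 1%N w))%R])) in
  [/\ (forall z : R, (0 <= z)%R ->
         'E_P[fun w => (expR (- z * S t w))%R] = LST z)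
      /\
      (forall mu : probability (measurableTypeR R) R,
         mu [set x : R | (0 <= x)%R] = 1 ->
         (forall z : R, (0 <= z)%R -> \int[mu]_x (expR (- z * x))%:E = LST z) ->
         forall B : set R, measurable B -> mu B = distribution P (S t) B),
      'E_P[Y1 1%N] < +oo -> 'E_P[Y2 1%N] < +oo ->
      'E_P[Y3 1%N] < +oo -> 'E_P[Y4 1%N] < +oo ->
      'E_P[S t] = t%:E * (lambda1%:E * 'E_P[Y1 1%N]
                    + lambda0%:E * ('E_P[Y3 1%N] + 'E_P[Y4 1%N])
                    + lambda2%:E * 'E_P[Y2 1%N]) &
      'E_P[fun w => (Y1 1%N w ^+ 2)%R] < +oo ->
      'E_P[fun w => (Y2 1%N w ^+ 2)%R] < +oo ->
      'E_P[fun w => (Y3 1%N w ^+ 2)%R] < +oo ->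
      'E_P[fun w => (Y4 1%N w ^+ 2)%R] < +oo ->
      'V_P[S t] = t%:E * (lambda1%:E * 'E_P[fun w => (Y1 1%N w ^+ 2)%R]
                    + lambda0%:E * 'E_P[fun w => ((Y3 1%N w + Y4 1%N w) ^+ 2)%R]
                    + lambda2%:E * 'E_P[fun w => (Y2 1%N w ^+ 2)%R])]%E.
Proof.
move=> S LST; split.
- have laplaceS z : (0 <= z)%R -> 'E_P[fun w => (expR (- z * S t w))%R]%E = LST z.
    by move=> z0; exact: (compound_laplace_formula hN hI).
  split => // mu mu0 muL B mB.
  have mge0 : measurable [set x : R | 0 <= x].
    rewrite (_ : [set x : R | 0 <= x] = `[0, +oo[%classic); first exact: measurable_itv.
    by apply/seteqP; split => x /=; rewrite in_itv/= andbT.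
  have law0 : distribution P (S t) [set x : R | 0 <= x] = 1%E.
    have mSge0 : measurable (S t @^-1` [set x : R | 0 <= x]).
      by rewrite -[X in measurable X]setTI; exact: measurable_funP.
    have S0 := measure_negligible (measurableC mSge0)
      (compound_sum_ge0 N hI_law hlambda0 hlambda1 hlambda2 hlambda hY_pos t).
    transitivity (P (~` ~` (S t @^-1` [set x : R | 0 <= x]))); first by rewrite setCK.
    by rewrite probability_setC ?S0 ?sube0//; exact: measurableC.
  (* R and measurableTypeR R carry the same measurable sets but are distinct
     as measurable types; the law of S(t) is taken on the type on which mu
     lives. *)
  pose X : T -> measurableTypeR R := S t.
  have mX : measurable_fun setT X by exact: measurable_compound_sum.
  pose XRV : {RV P >-> measurableTypeR R} :=
    HB.pack X (isMeasurableFun.Build _ _ _ _ X mX).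
  have eq_law := @laplace_injective R mu (distribution P XRV) mu0 law0.
  apply: eq_law mB => z z0.
  rewrite muL// -laplaceS// unlock ge0_integral_distribution//.
  apply/measurable_EFinP; apply: (measurableT_comp (@measurable_expR R)).
  exact: measurable_funM.
- exact: (compound_mean_formula hN hI).
- exact: (compound_variance_formula hN hI).
Qed.
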